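(* The class of finite simple graphs $\{ G \mid c_2(G)\leq 2 \}$ is the class of $\mathcal{F}$-free graphs, where \[\mathcal{F}=\{P_4,\; P_3+K_2,\; 3K_2,\; \text{full house},\; \text{dart},\; \ltimes,\; K_{3,3},\; W_5\}.\] That is, for every finite simple graph $G$, $c_2(G)\leq 2$ if and only if no induced subgraph of $G$ is isomorphic to a graph in $\mathcal{F}$.
   Context: All graphs are finite and simple. A subgraph complementation system for a graph $G=(V,E)$ is a finite collection (family) $\mathscr{C}$ of subsets of $V$ such that, for any two distinct vertices $u,v\in V$, $uv\in E$ if and only if $u$ and $v$ appear together in an odd number of sets in $\mathscr{C}$. The subgraph complementation number $c_2(G)$ is the minimum cardinality of a subgraph complementation system for $G$. Notation: $P_n$ is the path on $n$ vertices, $K_n$ the complete graph on $n$ vertices, $K_{3,3}$ the complete bipartite graph with both parts of size 3; $G+H$ denotes disjoint union and $3K_2$ is the disjoint union of three copies of $K_2$; $W_5$ is the wheel on 5 vertices in total (a 4-cycle together with one further vertex adjacent to all four vertices of the cycle). The remaining graphs each have vertex set $\{0,1,2,3,4\}$: the full house has edges $01,04,12,13,14,23,24,34$ (a $K_4$ on $\{1,2,3,4\}$ plus a vertex $0$ adjacent to exactly $1$ and $4$); the dart has edges $01,03,04,13,14,12$ ($K_4$ minus the edge $34$ on $\{0,1,3,4\}$, plus a pendant vertex $2$ attached to the vertex $1$, which has degree 3 in that $K_4$ minus an edge); $\ltimes$ has edges $01,12,02,23,24$ (a triangle with two pendant vertices attached to the same vertex of the triangle). *)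

(* Defs.v *)
From mathcomp Require Import all_boot.
From Stdlib Require List.

Set Implicit Arguments.
Unset Strict Implicit.
Unset Printing Implicit Defensive.

Record sgraph := SGraph {
  svertex :> finType;
  sedge : rel svertex;
  sedge_sym : symmetric sedge;
  sedge_irrefl : irreflexive sedge
}.

Arguments sedge {s} x y.

Definition isomorphic (G H : sgraph) : Prop :=
  exists2 f : G -> H, bijective f & forall x y : G, sedge (f x) (f y) = sedge x y.

Section Induced.
Variables (G : sgraph) (A : {set G}).

Definition induced_rel : rel {x : G | x \in A} :=
  fun x y => sedge (val x) (val y).

Lemma induced_sym : symmetric induced_rel.
Proof. by move=> x y; exact: sedge_sym. Qed.

Lemma induced_irrefl : irreflexive induced_rel.
Proof. by move=> x; exact: sedge_irrefl. Qed.

Definition induced : sgraph := SGraph induced_sym induced_irrefl.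
End Induced.

Definition free (Fs : seq sgraph) (G : sgraph) : Prop :=
  forall H : sgraph, List.In H Fs ->
    ~ exists A : {set G}, isomorphic (induced A) H.

(* A subgraph complementation system is a family, so it is a sequence of
   vertex sets: repeated members count with their multiplicity, both in the
   parity condition and in the cardinality. *)
Section SubgraphComplementation.
Variable G : sgraph.

Definition sc_system (C : seq {set G}) : bool :=
  [forall u : G, forall v : G, (u != v) ==>
    (sedge u v == odd (count (fun A : {set G} => (u \in A) && (v \in A)) C))].

Definition has_sc_system (k : nat) : bool :=
  [exists C : k.-tuple {set G}, sc_system C].

Lemma has_sc_system_ex : exists k : nat, has_sc_system k.
Proof.
pose E := [set A : {set G} | [exists x, exists y, sedge x y && (A == [set x; y])]].
exists (size (enum E)); apply/existsP; exists (in_tuple (enum E)).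
apply/forallP=> u; apply/forallP=> v; apply/implyP=> uv; apply/eqP => /=.
have EP A : A \in E -> u \in A -> v \in A -> sedge u v /\ A = [set u; v].
  rewrite inE => /existsP[x /existsP[y /andP[exy /eqP->]]].
  rewrite !inE => /orP[]/eqP ux /orP[]/eqP vy; subst u v.
  - by rewrite eqxx in uv.
  - by [].
  - by rewrite sedge_sym setUC.
  - by rewrite eqxx in uv.
case: (boolP (sedge u v)) => euv.
  rewrite (@eq_in_count _ _ (pred1 [set u; v])); last first.
    move=> A; rewrite mem_enum => AE /=.
    apply/andP/eqP => [[uA vA]|->]; first by case: (EP A AE uA vA).
    by rewrite !inE !eqxx orbT.
  rewrite count_uniq_mem ?enum_uniq // mem_enum inE.
  suff -> : [exists x, exists y, sedge x y && ([set u; v] == [set x; y])] by [].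
  by apply/existsP; exists u; apply/existsP; exists v; rewrite euv eqxx.
rewrite (@eq_in_count _ _ pred0) ?count_pred0 // => A; rewrite mem_enum => AE /=.
by apply/negP => /andP[uA vA]; case: (EP A AE uA vA) => h; rewrite h in euv.
Qed.

Definition c2 : nat := ex_minn has_sc_system_ex.
End SubgraphComplementation.

Section EdgeList.
Variables (n : nat) (s : seq (nat * nat)).

Definition edges_rel : rel 'I_n := fun x y =>
  (x != y) && (((x : nat, y : nat) \in s) || ((y : nat, x : nat) \in s)).

Lemma edges_sym : symmetric edges_rel.
Proof. by move=> x y; rewrite /edges_rel eq_sym orbC. Qed.

Lemma edges_irrefl : irreflexive edges_rel.
Proof. by move=> x; rewrite /edges_rel eqxx. Qed.

Definition graph_of_edges : sgraph := SGraph edges_sym edges_irrefl.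
End EdgeList.

Section Path.
Variable n : nat.

Definition path_rel : rel 'I_n := fun x y => (x.+1 == y) || (y.+1 == x).

Lemma path_sym : symmetric path_rel.
Proof. by move=> x y; rewrite /path_rel orbC. Qed.

Lemma path_irrefl : irreflexive path_rel.
Proof. by move=> x; rewrite /path_rel orbb gtn_eqF. Qed.

Definition path_graph : sgraph := SGraph path_sym path_irrefl.
End Path.

Section Complete.
Variable n : nat.

Definition complete_rel : rel 'I_n := fun x y => x != y.

Lemma complete_sym : symmetric complete_rel.
Proof. by move=> x y; rewrite /complete_rel eq_sym. Qed.

Lemma complete_irrefl : irreflexive complete_rel.
Proof. by move=> x; rewrite /complete_rel eqxx. Qed.

Definition complete_graph : sgraph := SGraph complete_sym complete_irrefl.
End Complete.

Section CompleteBipartite.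
Variables m n : nat.

Definition bipartite_rel : rel ('I_m + 'I_n)%type := fun x y =>
  match x, y with
  | inl _, inr _ | inr _, inl _ => true
  | _, _ => false
  end.

Lemma bipartite_sym : symmetric bipartite_rel.
Proof. by move=> [x|x] [y|y]. Qed.

Lemma bipartite_irrefl : irreflexive bipartite_rel.
Proof. by move=> [x|x]. Qed.

Definition complete_bipartite : sgraph := SGraph bipartite_sym bipartite_irrefl.
End CompleteBipartite.

Section DisjointUnion.
Variables G H : sgraph.

Definition dunion_rel : rel (G + H)%type := fun x y =>
  match x, y with
  | inl a, inl b => sedge a b
  | inr a, inr b => sedge a b
  | _, _ => false
  end.

Lemma dunion_sym : symmetric dunion_rel.
Proof. by move=> [x|x] [y|y] //=; exact: sedge_sym. Qed.

Lemma dunion_irrefl : irreflexive dunion_rel.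
Proof. by move=> [x|x] /=; exact: sedge_irrefl. Qed.

Definition dunion : sgraph := SGraph dunion_sym dunion_irrefl.
End DisjointUnion.

Definition full_house : sgraph :=
  graph_of_edges 5 [:: (0, 1); (0, 4); (1, 2); (1, 3); (1, 4); (2, 3); (2, 4); (3, 4)].

Definition dart : sgraph :=
  graph_of_edges 5 [:: (0, 1); (0, 3); (0, 4); (1, 3); (1, 4); (1, 2)].

Definition ltimes : sgraph :=
  graph_of_edges 5 [:: (0, 1); (1, 2); (0, 2); (2, 3); (2, 4)].

(* The 4-cycle 0123 together with the vertex 4. *)
Definition wheel5 : sgraph :=
  graph_of_edges 5 [:: (0, 1); (1, 2); (2, 3); (0, 3); (0, 4); (1, 4); (2, 4); (3, 4)].

Definition forbidden : seq sgraph :=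
  [:: path_graph 4;
      dunion (path_graph 3) (complete_graph 2);
      dunion (complete_graph 2) (dunion (complete_graph 2) (complete_graph 2));
      full_house;
      dart;
      ltimes;
      complete_bipartite 3 3;
      wheel5].

(* Main.v *)
(** A system of two sets is a labelling of the vertices by elements of
    [bool * bool], and it makes [G] the disjoint union of an independent set
    (label 00) with the join of [K_p + K_q] (labels P = 10 and Q = 01) and an independent
    set (label R = 11).  Some small induced subgraphs force such a labelling:
    if [S] is a labelled copy of 2K_2, the paw, the diamond, K_{1,3}, C_4, P_3,
    K_2 or the empty graph, and [S] is the first of these which occurs in [G],
    then the adjacencies of an outside vertex to [S] either single out its
    label or create a forbidden graph or an earlier member of this list, and
    two outside vertices are adjacent exactly as their labels prescribe, for
    the same reason.  Since [S] has at most four vertices this only concerns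
    graphs on at most six vertices, and is checked by computation. *)

Require Import Defs.
From mathcomp Require Import all_boot.

Set Implicit Arguments.
Unset Strict Implicit.
Unset Printing Implicit Defensive.

(** * Codes of ordered vertex lists and induced copies *)

Section Triangle.
Variables (T : eqType).
Implicit Types (r : rel T) (s : seq T).

(** The strict upper triangle of the adjacency matrix in the order [s]: plain data that can be
    compared by computation. *)
Fixpoint tri r s : seq (seq bool) :=
  if s is x :: s' then [seq r x y | y <- s'] :: tri r s' else [::].

Lemma size_tri r s : size (tri r s) = size s.
Proof. by elim: s => //= x s ->. Qed.

Lemma eq_tri r r' s : uniq s ->
  {in s &, forall x y, x != y -> r x y = r' x y} -> tri r s = tri r' s.
Proof.
elim: s => //= x s IHs /andP[xs us] rr'; congr (_ :: _).
  apply/eq_in_map => y ys; apply: rr'; rewrite ?inE ?eqxx ?ys ?orbT //.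
  by apply: contraNneq xs => ->.
by apply: IHs => // y z ys zs; apply: rr'; rewrite inE ?ys ?zs orbT.
Qed.
End Triangle.

Lemma tri_map (T U : eqType) (r : rel U) (f : T -> U) s :
  tri r (map f s) = tri (fun x y => r (f x) (f y)) s.
Proof. by elim: s => //= x s ->; rewrite -map_comp. Qed.

Fixpoint adj (M : seq (seq bool)) (i j : nat) : bool :=
  if M is row :: M' then
    match i, j with
    | 0, 0 => false
    | 0, k.+1 | k.+1, 0 => nth false row k
    | i'.+1, j'.+1 => adj M' i' j'
    end
  else false.

Lemma adj_tri (T : eqType) (r : rel T) (x0 : T) s i j :
  symmetric r -> irreflexive r -> i < size s -> j < size s ->
  adj (tri r s) i j = r (nth x0 s i) (nth x0 s j).
Proof.
move=> r_sym r_irr; elim: s i j => //= x s IHs [|i] [|j] //= ilt jlt.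
- by rewrite (nth_map x0).
- by rewrite (nth_map x0) // r_sym.
- exact: IHs.
Qed.

Definition occurs (T : eqType) (r : rel T) (M : seq (seq bool)) : Prop :=
  exists2 s : seq T, uniq s & tri r s = M.

(** Makes occurrence decidable, so that the proof can branch on whether a seed occurs. *)
Lemma occursP (T : finType) (r : rel T) M :
  reflect (occurs r M) [exists t : (size M).-tuple T, uniq t && (tri r t == M)].
Proof.
apply: (iffP existsP) => [[t /andP[ut /eqP tM]]|[s us sM]]; first by exists t.
have ss : size s == size M by rewrite -sM size_tri.
by exists (Tuple ss); rewrite /= us sM eqxx.
Qed.

Section InducedCopies.
Variables (G H : sgraph) (t : seq H).
Hypotheses (t_uniq : uniq t) (t_full : forall y, y \in t).

Lemma occurs_induced :
  (exists A : {set G}, isomorphic (induced A) H) <->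
  occurs (@sedge G) (tri (@sedge H) t).
Proof.
split=> [[A [f [g fK gK] fe]]|[s s_uniq st]].
  exists [seq val (g y) | y <- t].
    by rewrite map_inj_uniq // => x y /val_inj /(can_inj gK).
  by rewrite tri_map; apply: eq_tri => // x y _ _ _; have := fe (g x) (g y); rewrite !gK.
have sz : size s = size t by rewrite -(size_tri (@sedge G)) st size_tri.
exists [set x in s].
have ixs (x : {x : G | x \in [set x in s]}) : index (val x) s < size t.
  by rewrite -sz index_mem; have := valP x; rewrite inE.
(* The map matching positions in [s] and [t] needs a default vertex for [nth]; if [H] has none, both
   graphs are empty. *)
have [y0 _|t0] := pickP (mem H); last first.
  have H0 (y : H) : False by have := t0 y.
  have A0 (x : {x : G | x \in [set x in s]}) : False.
    by have := ixs x; case: (t) => [|y ? _] //; case: (H0 y).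
  exists (fun x => match A0 x with end); last by move=> x; case: (A0 x).
  by exists (fun y => match H0 y with end) => x; [case: (A0 x)|case: (H0 x)].
have gP y x0 : nth x0 s (index y t) \in [set x in s].
  by rewrite inE mem_nth // sz index_mem.
pose f (x : induced [set x in s]) : H := nth y0 t (index (val x) s).
have e_f x y : sedge (f x) (f y) = sedge x y.
  rewrite -(adj_tri y0) ?ixs //; last 2 first.
  - exact: sedge_sym.
  - exact: sedge_irrefl.
  rewrite -st (adj_tri (val x)) ?sz ?ixs //; last 2 first.
  - exact: sedge_sym.
  - exact: sedge_irrefl.
  by rewrite !nth_index //; [have := valP y|have := valP x]; rewrite inE.
exists f => //.
have finj : injective f.
  move=> x y /eqP; rewrite /f nth_uniq ?ixs // => /eqP ixy; apply: val_inj.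
  have xs : val x \in s by have := valP x; rewrite inE.
  have ys : val y \in s by have := valP y; rewrite inE.
  by rewrite /= -(nth_index (val x) xs) -[in RHS](nth_index (val x) ys) ixy.
apply: inj_card_bij => //.
have -> : #|induced [set x in s]| = size t.
  by rewrite /= card_sig -sz -(card_uniqP s_uniq); apply: eq_card => x; rewrite !inE.
by rewrite -(card_uniqP t_uniq) subset_leq_card //; apply/subsetP=> y _.
Qed.
End InducedCopies.

(** * Systems of at most two sets as labellings *)

Definition label := (bool * bool)%type.

(** The dot product on F_2^2, that is, the parity of the number of sets containing both vertices. *)
Definition lab (a b : label) : bool := (a.1 && b.1) (+) (a.2 && b.2).

Lemma lab_sym : symmetric lab.
Proof. by move=> a b; rewrite /lab andbC [in X in _ (+) X]andbC. Qed.

Lemma c2_le2P (G : sgraph) :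
  c2 G <= 2 <->
  exists f : G -> label, forall u v, u != v -> sedge u v = lab (f u) (f v).
Proof.
rewrite /c2; case: ex_minnP => m /existsP[[C /= sC] scC] m_min; split.
  (* The default [set0] pads a system of fewer than two sets without changing any parity. *)
  move=> m2; exists (fun u => (u \in nth set0 C 0, u \in nth set0 C 1)) => u v uv.
  move/forallP/(_ u)/forallP/(_ v): scC; rewrite uv => /eqP -> /=.
  have : size C <= 2 by rewrite (eqP sC).
  case: (C) => [|A [|B [|]]] //= _; rewrite /lab /= ?inE ?addn0 ?addbF ?andbF //.
    by rewrite oddb.
  by rewrite oddD !oddb.
move=> [f fP]; apply: m_min; apply/existsP.
exists [tuple [set u | (f u).1]; [set u | (f u).2]].
apply/forallP => u; apply/forallP => v; apply/implyP => /fP ->.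
by rewrite /= !inE addn0 oddD !oddb.
Qed.

(** * The finite check around a seed *)

Fixpoint words (A : eqType) (a : seq A) n : seq (seq A) :=
  if n is n'.+1 then [seq c :: w | c <- a, w <- words a n'] else [:: [::]].

Lemma mem_words (A : eqType) (a s : seq A) : {subset s <= a} -> s \in words a (size s).
Proof.
elim: s => //= x s IHs sa.
apply/allpairsP; exists (x, s); rewrite /= sa ?mem_head ?IHs // => y ys.
by apply: sa; rewrite inE ys orbT.
Qed.

Definition bools := [:: false; true].
Definition labels : seq label := [seq (a, b) | a <- bools, b <- bools].

(** Every ordered choice of distinct positions is a prefix of some permutation of all positions. *)
Definition contains (F : seq (seq (seq bool))) (M : seq (seq bool)) : bool :=
  has (fun p : seq nat => has (fun N => tri (adj M) (take (size N) p) == N) F)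
      (permutations (iota 0 (size M))).

Definition avoids (T : eqType) (r : rel T) (F : seq (seq (seq bool))) : Prop :=
  forall N, N \in F -> ~ occurs r N.

Lemma avoids_contains (T : eqType) (r : rel T) F s :
  symmetric r -> irreflexive r -> avoids r F -> uniq s -> ~~ contains F (tri r s).
Proof.
move=> r_sym r_irr rF us; apply/hasPn => p; rewrite mem_permutations size_tri => ps.
apply/hasPn => N NF; apply/eqP => pN; case: (rF N NF).
case: s us ps pN => [|x0 s] us ps pN.
  by rewrite -pN (perm_small_eq _ ps) //; exists [::].
have up : uniq (take (size N) p) by rewrite take_uniq // (perm_uniq ps) iota_uniq.
have lt_p i : i \in take (size N) p -> i < size (x0 :: s).
  by move/mem_take; rewrite (perm_mem ps) mem_iota.
exists [seq nth x0 (x0 :: s) i | i <- take (size N) p].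
  by rewrite map_inj_in_uniq // => i j /lt_p il /lt_p jl /eqP; rewrite nth_uniq // => /eqP.
rewrite tri_map -[RHS]pN; apply: eq_tri => // i j /lt_p il /lt_p jl _.
by rewrite -(adj_tri x0).
Qed.

(* The label of an outside vertex whose adjacencies to the seed are [row]; it
   means nothing unless [explained L row]. *)
Definition infer (L : seq label) (row : seq bool) : label :=
  head (false, false) [seq c <- labels | map (lab c) L == row].

Definition explained L row := map (lab (infer L row)) L == row.

(** A row that fits no label must create a code of [F], and so must two outside vertices with the
    wrong adjacency, which is what the [~~] encodes. *)
Definition seed_check F L : bool :=
  let rows := words bools (size L) in
  let good := filter (explained L) rows in
  all (fun row => contains F (row :: tri lab L)) (filter (predC (explained L)) rows)
  && all (fun row1 => all (fun row2 => contains F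
        ((~~ lab (infer L row1) (infer L row2) :: row1) :: row2 :: tri lab L)) good) good.

(** * Extending the labelling of a seed to the whole graph *)

Section Seed.
Variables (G : sgraph) (F : seq (seq (seq bool))) (L : seq label) (s : seq G).
Hypotheses (GF : avoids (@sedge G) F) (FL : seed_check F L).
Hypotheses (s_uniq : uniq s) (sL : tri (@sedge G) s = tri lab L).

Let row (x : G) := [seq sedge x y | y <- s].

Lemma size_seed : size L = size s.
Proof. by rewrite -(size_tri (@sedge G)) sL size_tri. Qed.

Lemma row_words x : row x \in words bools (size L).
Proof.
by rewrite size_seed -(size_map (sedge x)); apply: mem_words => -[].
Qed.

Lemma row_explained x : x \notin s -> explained L (row x).
Proof.
move=> xs; apply: contraT => bad.
have /andP[/allP/(_ (row x)) + _] := FL.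
rewrite mem_filter /= bad row_words => /(_ isT).
rewrite -sL -[_ :: _]/(tri _ (x :: s)); apply: contraTT => _.
by apply: avoids_contains; rewrite ?GF //= ?xs //; [exact: sedge_sym|exact: sedge_irrefl].
Qed.

Lemma row_pair x y : x \notin s -> y \notin s -> x != y ->
  sedge x y = lab (infer L (row x)) (infer L (row y)).
Proof.
move=> xs ys xy; apply/eqP; apply: contraT => bad.
have /andP[_ /allP/(_ (row x))] := FL.
rewrite mem_filter row_explained // row_words => /(_ isT)/allP/(_ (row y)).
rewrite mem_filter row_explained // row_words => /(_ isT).
(* Under the assumed disagreement, the matrix examined by the check is the actual code of [x], [y]
   and the seed. *)
have -> : ~~ lab (infer L (row x)) (infer L (row y)) = sedge x y.
  by move: bad; case: sedge; case: lab.
rewrite -sL -[_ :: _]/(tri _ [:: x, y & s]); apply: contraTT => _.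
apply: avoids_contains; rewrite ?GF //= ?inE ?negb_or ?xy ?xs ?ys //.
  exact: sedge_sym.
exact: sedge_irrefl.
Qed.

Let f x := if x \in s then nth (false, false) L (index x s) else infer L (row x).

Lemma seed_out_in x y : x \notin s -> y \in s -> sedge x y = lab (f x) (f y).
Proof.
move=> xs ys; rewrite /f (negPf xs) ys.
have /eqP := row_explained xs; move/(congr1 (fun w => nth false w (index y s))).
rewrite (nth_map (false, false)) ?size_seed ?index_mem // => ->.
by rewrite (nth_map x) ?index_mem // nth_index.
Qed.

Lemma seed_in_in x y : x \in s -> y \in s -> x != y -> sedge x y = lab (f x) (f y).
Proof.
rewrite /f => xs ys; rewrite xs ys.
move: s L sL s_uniq xs ys; elim=> //= z s' IHs [|c L'] //= [zr sL'] /andP[zs us].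
have out y' : y' \in s' -> sedge z y' = lab c (nth (false, false) L' (index y' s')).
  move=> y's; have sz : size L' = size s' by rewrite -(size_map (lab c)) -zr size_map.
  move/(congr1 (fun w => nth false w (index y' s'))): zr.
  rewrite (nth_map z) ?index_mem // nth_index // => ->.
  by rewrite (nth_map (false, false)) // sz index_mem.
rewrite !inE; case: eqVneq => [->|xz] /=; case: eqVneq => [->|yz] //=.
- by move=> _ ys _; rewrite out.
- by move=> xs _ _; rewrite sedge_sym lab_sym out.
- exact: IHs.
Qed.

Lemma seed_labelling : exists g : G -> label,
  forall u v, u != v -> sedge u v = lab (g u) (g v).
Proof.
exists f => u v uv; case: (boolP (u \in s)) => us; case: (boolP (v \in s)) => vs.
- exact: seed_in_in.
- by rewrite sedge_sym lab_sym seed_out_in.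
- exact: seed_out_in.
- by rewrite /f (negPf us) (negPf vs) row_pair.
Qed.
End Seed.

(* Seeds are tried in order, so the earlier ones may be added to the forbidden
   codes; the empty seed always occurs and ends the search. *)
Fixpoint seeds_check F (Ls : seq (seq label)) : bool :=
  if Ls is L :: Ls' then seed_check F L && seeds_check (tri lab L :: F) Ls'
  else seed_check F [::].

Lemma seeds_labelling (G : sgraph) F Ls :
  avoids (@sedge G) F -> seeds_check F Ls ->
  exists g : G -> label, forall u v, u != v -> sedge u v = lab (g u) (g v).
Proof.
elim: Ls F => /= [|L Ls IHs] F GF; first by move=> FL; apply: (@seed_labelling G F [::] [::]).
case/andP=> FL FLs.
case: (occursP (@sedge G) (tri lab L)) => [[s us sL]|nL].
  exact: seed_labelling GF FL us sL.
by apply: IHs FLs => N; rewrite inE => /predU1P[->|/GF].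
Qed.

(* Unlike [enum 'I_n], this list evaluates. *)
Fixpoint ords n : seq 'I_n :=
  if n is n'.+1 then ord0 :: map (lift ord0) (ords n') else [::].

Lemma ords_enum n : ords n = enum 'I_n.
Proof.
elim: n => [|n IHn]; last by rewrite enum_ordSl -IHn.
by apply/esym/size0nil; rewrite size_enum_ord.
Qed.

Lemma uniq_ords n : uniq (ords n).
Proof. by rewrite ords_enum enum_uniq. Qed.

Lemma mem_ords n i : i \in ords n.
Proof. by rewrite ords_enum mem_enum. Qed.

Definition osum (T U : eqType) (s : seq T) (t : seq U) : seq (T + U)%type :=
  map inl s ++ map inr t.

Lemma uniq_osum (T U : eqType) (s : seq T) (t : seq U) :
  uniq s -> uniq t -> uniq (osum s t).
Proof.
move=> us ut; rewrite cat_uniq !map_inj_uniq ?us ?ut => [|x y []|x y []] //.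
by rewrite andbT; apply/hasPn => _ /mapP[x _ ->]; apply/mapP => -[].
Qed.

Lemma mem_osum (T U : eqType) (s : seq T) (t : seq U) :
  (forall x, x \in s) -> (forall y, y \in t) -> forall z, z \in osum s t.
Proof.
by move=> sT tU [x|y]; rewrite mem_cat ?map_f ?orbT.
Qed.

(** * The forbidden graphs as codes *)

Definition ordered_graph := {H : sgraph & seq H}.

Definition code (t : ordered_graph) := tri (@sedge (projT1 t)) (projT2 t).

Definition enumerated (t : ordered_graph) : Prop :=
  let: existT H s := t in uniq s /\ forall y : H, y \in s.

Lemma free_avoids (G : sgraph) (ts : seq ordered_graph) :
  List.Forall enumerated ts ->
  free (map (@projT1 _ _) ts) G <-> avoids (@sedge G) (map code ts).
Proof.
elim=> [|[H t] {}ts [/= ut mt] _ IHts] /=; first by split=> _ N.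
have occ := occurs_induced G ut mt; split=> [Gfree N|Gav K].
  rewrite inE => /predU1P[->|]; first by rewrite -occ; apply: Gfree; left.
  by apply: (iffLR IHts) => K Kts; apply: Gfree; right.
case=> [<-|]; first by rewrite occ; apply: Gav; rewrite mem_head.
by apply: (iffRL IHts) => N Nts; apply: Gav; rewrite inE Nts orbT.
Qed.

Definition ordered_forbidden : seq ordered_graph :=
  let ordered H t : ordered_graph := existT (fun H : sgraph => seq H) H t in
  let K2 := complete_graph 2 in
  [:: ordered (path_graph 4) (ords 4);
      ordered (dunion (path_graph 3) K2) (osum (ords 3) (ords 2));
      ordered (dunion K2 (dunion K2 K2)) (osum (ords 2) (osum (ords 2) (ords 2)));
      ordered full_house (ords 5);
      ordered dart (ords 5);
      ordered ltimes (ords 5);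
      ordered (complete_bipartite 3 3) (osum (ords 3) (ords 3));
      ordered wheel5 (ords 5)].

Lemma ordered_forbiddenP :
  List.Forall enumerated ordered_forbidden.
Proof.
by do ![constructor]; rewrite /= ?uniq_osum ?uniq_ords //;
  do ?[apply: mem_osum | apply: mem_ords].
Qed.

(** The labels along a copy of [N] form a word whose [lab] triangle is [N], so it suffices to try
    all words of that length. *)
Lemma labelling_avoids (T : eqType) (r : rel T) (f : T -> label) F :
  (forall u v, u != v -> r u v = lab (f u) (f v)) ->
  all (fun N => N \notin [seq tri lab w | w <- words labels (size N)]) F ->
  avoids r F.
Proof.
move=> rf /allP Fn N /Fn /negP + [s us sN]; apply.
rewrite -sN size_tri -(size_map f); apply/mapP; exists (map f s).
  by apply: mem_words => -[[] []].
by rewrite tri_map; apply: eq_tri => // x y _ _; apply: rf.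
Qed.

(* 2K_2, paw, diamond, K_{1,3}, C_4, P_3 and K_2. *)
Definition seeds : seq (seq label) :=
  let P := (true, false) in let Q := (false, true) in let R := (true, true) in
  [:: [:: P; P; Q; Q]; [:: P; P; Q; R]; [:: P; P; R; R]; [:: P; R; R; R];
      [:: P; Q; R; R]; [:: P; Q; R]; [:: P; P]].

Theorem theorem5p5 (G : sgraph) : c2 G <= 2 <-> free forbidden G.
Proof.
rewrite c2_le2P (free_avoids G ordered_forbiddenP); split=> [[f fG]|GF].
  by apply: labelling_avoids fG _; vm_compute.
by apply: (seeds_labelling GF (Ls := seeds)); vm_compute.
Qed.
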